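(* Let $A$ be a Hopf algebra over a field $k$. (1) Every generalised left covariant differential calculus on $A$ is isomorphic to one of the form $\Omega^1=A\otimes\Lambda^1$, $\mathrm{d}a=a_{(1)}\otimes\omega(\pi(a_{(2)}))$, and such calculi are given by any data $(\Lambda^1,\omega)$ where $\Lambda^1$ is a right $A$-module and $\omega:A^+\to\Lambda^1$ is a right $A$-module map. (2) Generalised bicovariant differential calculi on $A$ are given in the same way by data $(\Lambda^1,\omega)$ where $\Lambda^1$ is a right $A$-crossed module and $\omega:A^+\to\Lambda^1$ is a morphism of right $A$-crossed modules. (3) The image $\bar\Lambda^1=\omega(A^+)$ together with $\omega$ gives the standard sub-calculus.
   Context: $k$ has characteristic not $2$; Sweedler notation $\Delta a=a_{(1)}\otimes a_{(2)}$ is used. A generalised first order differential calculus on $A$ is an $A$-bimodule $\Omega^1$ with linear $\mathrm{d}:A\to\Omega^1$ obeying $\mathrm{d}(ab)=(\mathrm{d}a)b+a\,\mathrm{d}b$ (no surjectivity of $\phi:a\otimes b\mapsto a\,\mathrm{d}b$ required); its standard sub-calculus is $\bar\Omega^1=\phi(A\otimes A)$ with $\mathrm{d}$. It is left covariant if equipped with a left coaction $\Delta_L:\Omega^1\to A\otimes\Omega^1$ that is a bimodule map ($A$ acting by the tensor product of its actions on $A$ by multiplication and on $\Omega^1$) and for which $\mathrm{d}$ is a left comodule map; it is bicovariant if it has commuting left and right coactions $\Delta_L,\Delta_R$, both bimodule maps, with $\mathrm{d}$ a bicomodule map. The coactions are part of the data. $A^+=\ker\epsilon$ and $\pi:A\to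 A^+$, $\pi(a)=a-\epsilon(a)1$. A right $A$-crossed module is a vector space $V$ with a right action $\triangleleft$ and right coaction $\Delta_R v=v_0\otimes v_1$ of $A$ such that $\Delta_R(v\triangleleft a)=v_0\triangleleft a_{(2)}\otimes (Sa_{(1)})v_1a_{(3)}$; morphisms are maps commuting with actions and coactions. $A^+$ is a right $A$-crossed module by $a\triangleleft b=ab$ and $\Delta_R(a)=a_{(2)}\otimes (Sa_{(1)})a_{(3)}$. On $A\otimes\Lambda^1$ the structures are: left action by left multiplication on $A$; $(a\otimes v).b=ab_{(1)}\otimes v\triangleleft b_{(2)}$; $\Delta_L=\Delta\otimes\mathrm{id}$; and, in the bicovariant case, $\Delta_R(a\otimes v)=a_{(1)}\otimes v_0\otimes a_{(2)}v_1$. *)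

(* Defs.v *)
From HB Require Import structures.
From mathcomp Require Import all_boot all_order all_algebra.
From mathcomp Require Import boolp.
Set Implicit Arguments.
Unset Strict Implicit.
Unset Printing Implicit Defensive.
Import GRing.Theory.
Local Open Scope ring_scope.
Local Open Scope quotient_scope.

Reserved Notation "v ⊗ w" (at level 40, left associativity).
Reserved Notation "\tlift_ ( x , y <- t ) E"
  (at level 36, E at level 36, x, y at level 50,
   format "'[' \tlift_ ( x ,  y  <-  t ) '/  '  E ']'").

Notation bilinear_map f := (bilinear_for *:%R *:%R f).

Section Tensor.
Variables (k : fieldType) (V W : lmodType k).
Implicit Types (r s : seq (V * W)).

(* The list [(v1, w1); ...; (vn, wn)] stands for the formal sum of the
   vi ⊗ wi. Two formal sums are identified when no bilinear map out of V x W
   separates them, which is the relation making the quotient universal; see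
   tlift_tens, tliftP and tlift_uniq. *)
Definition formal_eval (U : lmodType k) (f : V -> W -> U) s : U :=
  \sum_(p <- s) f p.1 p.2.

Definition tens_equiv : rel (seq (V * W)) := fun r s =>
  `[< forall (U : lmodType k) (f : V -> W -> U), bilinear_map f ->
        formal_eval f r = formal_eval f s >].

Fact tens_equiv_refl : reflexive tens_equiv.
Proof. by move=> s; apply/asboolP. Qed.

Fact tens_equiv_sym : symmetric tens_equiv.
Proof.
by move=> r s; apply/asboolP/asboolP => h U f bf; rewrite h.
Qed.

Fact tens_equiv_trans : transitive tens_equiv.
Proof.
move=> s r t /asboolP h1 /asboolP h2; apply/asboolP => U f bf.
by rewrite h1 // h2.
Qed.

Canonical tens_equiv_rel :=
  EquivRel tens_equiv tens_equiv_refl tens_equiv_sym tens_equiv_trans.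

Definition tensor := {eq_quot tens_equiv_rel}.

HB.instance Definition _ : EqQuotient _ tens_equiv_rel tensor :=
  EqQuotient.on tensor.
HB.instance Definition _ := Choice.on tensor.

Definition formal_scale (c : k) s := [seq (c *: p.1, p.2) | p <- s].

Definition tens (v : V) (w : W) : tensor := \pi_tensor [:: (v, w)].
Definition tens_zero : tensor := \pi_tensor [::].
Definition tens_add (x y : tensor) : tensor := \pi_tensor (repr x ++ repr y).
Definition tens_scale (c : k) (x : tensor) : tensor :=
  \pi_tensor (formal_scale c (repr x)).
Definition tens_opp (x : tensor) : tensor := tens_scale (- 1) x.

(* Only meaningful for bilinear f, in which case it is the linear map with
   v ⊗ w |-> f v w; for other f it depends on the chosen representatives. *)
Definition tlift (U : lmodType k) (f : V -> W -> U) (x : tensor) : U :=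
  formal_eval f (repr x).

Lemma tensP (x y : tensor) :
  (forall (U : lmodType k) (f : V -> W -> U), bilinear_map f ->
     tlift f x = tlift f y) -> x = y.
Proof.
by move=> h; rewrite -[x]reprK -[y]reprK; apply/eqquotP/asboolP => U f /h.
Qed.

Section Lift.
Variables (U : lmodType k) (f : V -> W -> U).
Hypothesis bf : bilinear_map f.

Lemma tlift_pi s : tlift f (\pi_tensor s) = formal_eval f s.
Proof.
have /eqquotP /asboolP h : repr (\pi_tensor s) = s %[mod tensor].
  by rewrite reprK.
exact: h.
Qed.

Lemma tlift_zero : tlift f tens_zero = 0.
Proof. by rewrite tlift_pi /formal_eval big_nil. Qed.

Lemma tlift_add x y : tlift f (tens_add x y) = tlift f x + tlift f y.
Proof. by rewrite tlift_pi /formal_eval big_cat. Qed.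

Lemma tlift_scale c x : tlift f (tens_scale c x) = c *: tlift f x.
Proof.
rewrite tlift_pi /formal_eval big_map /= scaler_sumr.
apply: eq_bigr => p _ /=.
by have := bf.1 p.2; move/scalable_linear => ->.
Qed.

Lemma tlift_opp x : tlift f (tens_opp x) = - tlift f x.
Proof. by rewrite tlift_scale scaleN1r. Qed.

Lemma tlift_tens v w : tlift f (tens v w) = f v w.
Proof. by rewrite tlift_pi /formal_eval big_seq1. Qed.

End Lift.

Definition tlift_simp := (tlift_zero, tlift_add, tlift_scale, tlift_opp).

Fact tens_addA : associative tens_add.
Proof. by move=> x y z; apply: tensP => U f bf; rewrite !tlift_simp ?addrA. Qed.
Fact tens_addC : commutative tens_add.
Proof. by move=> x y; apply: tensP => U f bf; rewrite !tlift_simp 1?addrC. Qed.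
Fact tens_add0 : left_id tens_zero tens_add.
Proof. by move=> x; apply: tensP => U f bf; rewrite !tlift_simp ?add0r. Qed.
Fact tens_addN : left_inverse tens_zero tens_opp tens_add.
Proof. by move=> x; apply: tensP => U f bf; rewrite !tlift_simp ?addNr. Qed.

HB.instance Definition _ :=
  GRing.isZmodule.Build tensor tens_addA tens_addC tens_add0 tens_addN.

Fact tens_scaleA a b x :
  tens_scale a (tens_scale b x) = tens_scale (a * b) x.
Proof. by apply: tensP => U f bf; rewrite !tlift_simp ?scalerA. Qed.
Fact tens_scale1 : left_id 1 tens_scale.
Proof. by move=> x; apply: tensP => U f bf; rewrite !tlift_simp ?scale1r. Qed.
Fact tens_scaleDr : right_distributive tens_scale +%R.
Proof.
by move=> c x y; apply: tensP => U f bf; rewrite !tlift_simp ?scalerDr.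
Qed.
Fact tens_scaleDl x : {morph tens_scale^~ x : a b / a + b}.
Proof.
by move=> a b; apply: tensP => U f bf; rewrite !tlift_simp ?scalerDl.
Qed.

HB.instance Definition _ := GRing.Zmodule_isLmodule.Build k tensor
  tens_scaleA tens_scale1 tens_scaleDr tens_scaleDl.

Lemma tens_bilinear : bilinear_map tens.
Proof.
split=> [w c v v' | v c w w'] /=; apply: tensP => U f bf;
  rewrite /GRing.add /GRing.scale /= !tlift_simp // !tlift_tens //.
  by have := bf.1 w c v v'.
by have := bf.2 v c w w'.
Qed.

Lemma tliftP (U : lmodType k) (f : V -> W -> U) :
  bilinear_map f -> linear (tlift f).
Proof. by move=> bf c x y; rewrite tlift_add // tlift_scale. Qed.

Lemma tens_sum (x : tensor) : x = \sum_(p <- repr x) tens p.1 p.2.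
Proof.
apply: tensP => U f bf.
have -> : tlift f (\sum_(p <- repr x) tens p.1 p.2) =
          \sum_(p <- repr x) tlift f (tens p.1 p.2).
  apply: (big_morph (tlift f)) => [y z|]; first exact: tlift_add.
  exact: tlift_zero.
by apply: eq_bigr => p _; rewrite tlift_tens.
Qed.

Lemma tlift_uniq (U : lmodType k) (f : V -> W -> U) (g : {linear tensor -> U}) :
  (forall v w, g (tens v w) = f v w) -> g =1 tlift f.
Proof.
move=> h x; rewrite {1}[x]tens_sum linear_sum /=.
by apply: eq_bigr => p _; rewrite h.
Qed.

End Tensor.

Arguments tensor {k} (V W)%_type_scope.
Notation "V ⊗ W" := (tensor V W) : type_scope.
Notation "v ⊗ w" := (tens v w) : ring_scope.
Notation "\tlift_ ( x , y <- t ) E" := (tlift (fun x y => E) t) : ring_scope.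

Section TensorMaps.
Variable k : fieldType.
Implicit Types U V W : lmodType k.

Definition tmap V W V' W' (f : V -> V') (g : W -> W') (t : V ⊗ W) : V' ⊗ W' :=
  \tlift_(v, w <- t) (f v ⊗ g w).

Definition tassoc U V W (t : (U ⊗ V) ⊗ W) : U ⊗ (V ⊗ W) :=
  \tlift_(s, w <- t) \tlift_(u, v <- s) (u ⊗ (v ⊗ w)).

Lemma tmap_bilinear V W V' W' (f : {linear V -> V'}) (g : {linear W -> W'}) :
  bilinear_map (fun v w => f v ⊗ g w).
Proof.
by split=> [w c v v' | v c w w'] /=; rewrite linearP;
  [apply: (tens_bilinear _ _).1 | apply: (tens_bilinear _ _).2].
Qed.

Lemma tmap_linear V W V' W' (f : {linear V -> V'}) (g : {linear W -> W'}) :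
  linear (tmap f g).
Proof. exact/tliftP/tmap_bilinear. Qed.

Lemma tmap_tens V W V' W' (f : {linear V -> V'}) (g : {linear W -> W'}) v w :
  tmap f g (v ⊗ w) = f v ⊗ g w.
Proof. exact/tlift_tens/tmap_bilinear. Qed.

Lemma linear_tlift V W U U' (g : U -> U') (f : V -> W -> U) t :
  linear g -> g (\tlift_(v, w <- t) f v w) = \tlift_(v, w <- t) g (f v w).
Proof.
move=> lg; pose G : {linear U -> U'} :=
  HB.pack g (GRing.isLinear.Build k U U' *:%R g lg).
exact: (linear_sum G).
Qed.

Lemma eq_tlift V W U (f g : V -> W -> U) t :
  (forall v w, f v w = g v w) ->
  \tlift_(v, w <- t) f v w = \tlift_(v, w <- t) g v w.
Proof. by move=> fg; apply: eq_bigr => p _. Qed.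

Lemma tliftB V W U (f g : V -> W -> U) t :
  \tlift_(v, w <- t) (f v w - g v w) =
  \tlift_(v, w <- t) f v w - \tlift_(v, w <- t) g v w.
Proof. exact: sumrB. Qed.

(* (a ⊗ b) . (v ⊗ w) = l1 a v ⊗ l2 b w *)
Definition tact (A B V W : lmodType k)
    (l1 : A -> V -> V) (l2 : B -> W -> W) (s : A ⊗ B) (t : V ⊗ W) : V ⊗ W :=
  \tlift_(a, b <- s) tmap (l1 a) (l2 b) t.

End TensorMaps.

HB.mixin Record Algebra_isHopf (k : fieldType) A of GRing.Algebra k A := {
  comul : A -> (A : lmodType k) ⊗ (A : lmodType k);
  counit : A -> k;
  antipode : A -> A;
  comul_linear : linear comul;
  counit_linear : linear_for *%R counit;
  antipode_linear : linear antipode;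
  comulA : forall a, tassoc (tmap comul id (comul a)) = tmap id comul (comul a);
  comul_counitl : forall a, \tlift_(a1, a2 <- comul a) (counit a1 *: a2) = a;
  comul_counitr : forall a, \tlift_(a1, a2 <- comul a) (counit a2 *: a1) = a;
  comul1 : comul 1 = 1 ⊗ 1;
  comulM : forall a b, comul (a * b) = tact *%R *%R (comul a) (comul b);
  counit1 : counit 1 = 1;
  counitM : forall a b, counit (a * b) = counit a * counit b;
  antipodel : forall a,
    \tlift_(a1, a2 <- comul a) (antipode a1 * a2) = counit a *: 1;
  antipoder : forall a,
    \tlift_(a1, a2 <- comul a) (a1 * antipode a2) = counit a *: 1
}.

#[short(type="hopfAlgType")]
HB.structure Definition HopfAlgebra (k : fieldType) :=
  {A of GRing.Algebra k A & Algebra_isHopf k A}.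

HB.instance Definition _ (k : fieldType) (A : hopfAlgType k) :=
  GRing.isLinear.Build k A (A ⊗ A)%type *:%R (@comul k A) (@comul_linear k A).
HB.instance Definition _ (k : fieldType) (A : hopfAlgType k) :=
  GRing.isLinear.Build k A k *%R (@counit k A) (@counit_linear k A).
HB.instance Definition _ (k : fieldType) (A : hopfAlgType k) :=
  GRing.isLinear.Build k A A *:%R (@antipode k A) (@antipode_linear k A).

Section Image.
Variables (k : fieldType) (U V : lmodType k) (f : {linear U -> V}).

Definition in_image : {pred V} := fun v => `[< exists u, f u = v >].

Fact in_image_submod : submod_closed in_image.
Proof.
split=> [|c x y /asboolP [u <-] /asboolP [v <-]]; apply/asboolP.
  by exists 0; rewrite linear0.
by exists (c *: u + v); rewrite linearP.
Qed.

HB.instance Definition _ := GRing.isSubmodClosed.Build k V in_image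
  in_image_submod.

Record lin_image := LinImage { image_val : V; _ : image_val \in in_image }.

HB.instance Definition _ := [isSub for image_val].
HB.instance Definition _ := [Choice of lin_image by <:].
HB.instance Definition _ := [SubChoice_isSubLmodule of lin_image by <:].

Fact to_image_subproof u : f u \in in_image.
Proof. by apply/asboolP; exists u. Qed.

Definition to_image u : lin_image := LinImage (to_image_subproof u).

Fact to_image_linear : linear to_image.
Proof. by move=> c u v; apply: val_inj; rewrite /= !linearP. Qed.

HB.instance Definition _ :=
  GRing.isLinear.Build k U lin_image *:%R to_image to_image_linear.

End Image.

Section Modules.
Variables (k : fieldType) (A : hopfAlgType k).
Implicit Types V W : lmodType k.

Definition left_module V (l : A -> V -> V) : Prop :=
  [/\ bilinear_map l, forall v, l 1 v = v
    & forall a b v, l (a * b) v = l a (l b v)].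

Definition right_module V (r : V -> A -> V) : Prop :=
  [/\ bilinear_map r, forall v, r v 1 = v
    & forall v a b, r v (a * b) = r (r v a) b].

Definition bimodule V (l : A -> V -> V) (r : V -> A -> V) : Prop :=
  [/\ left_module l, right_module r & forall a v b, r (l a v) b = l a (r v b)].

Definition left_comodule V (D : V -> A ⊗ V) : Prop :=
  [/\ linear D, forall v, tassoc (tmap comul id (D v)) = tmap id D (D v)
    & forall v, \tlift_(a, w <- D v) (counit a *: w) = v].

Definition right_comodule V (D : V -> V ⊗ A) : Prop :=
  [/\ linear D, forall v, tassoc (tmap D id (D v)) = tmap id comul (D v)
    & forall v, \tlift_(w, a <- D v) (counit a *: w) = v].

Definition bicomodule V (DL : V -> A ⊗ V) (DR : V -> V ⊗ A) : Prop :=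
  [/\ left_comodule DL, right_comodule DR
    & forall v, tassoc (tmap DL id (DR v)) = tmap id DR (DL v)].

Definition tensor_lact V W (lV : A -> V -> V) (lW : A -> W -> W)
  (a : A) (t : V ⊗ W) : V ⊗ W := tact lV lW (comul a) t.

Definition tensor_ract V W (rV : V -> A -> V) (rW : W -> A -> W)
    (t : V ⊗ W) (a : A) : V ⊗ W :=
  tact (fun b v => rV v b) (fun b w => rW w b) (comul a) t.

Definition left_module_map V W (lV : A -> V -> V) (lW : A -> W -> W)
  (f : V -> W) : Prop := linear f /\ forall a v, f (lV a v) = lW a (f v).

Definition right_module_map V W (rV : V -> A -> V) (rW : W -> A -> W)
  (f : V -> W) : Prop := linear f /\ forall v a, f (rV v a) = rW (f v) a.

Definition bimodule_map V W (lV : A -> V -> V) (rV : V -> A -> V)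
    (lW : A -> W -> W) (rW : W -> A -> W) (f : V -> W) : Prop :=
  left_module_map lV lW f /\ right_module_map rV rW f.

Definition left_comodule_map V W (DV : V -> A ⊗ V) (DW : W -> A ⊗ W)
  (f : V -> W) : Prop := linear f /\ forall v, DW (f v) = tmap id f (DV v).

Definition right_comodule_map V W (DV : V -> V ⊗ A) (DW : W -> W ⊗ A)
  (f : V -> W) : Prop := linear f /\ forall v, DW (f v) = tmap f id (DV v).

Definition crossed_module V (r : V -> A -> V) (D : V -> V ⊗ A) : Prop :=
  [/\ right_module r, right_comodule D
    & forall v a,
        D (r v a) =
        \tlift_(a1, a' <- comul a) \tlift_(a2, a3 <- comul a')
          \tlift_(v0, v1 <- D v) (r v0 a2 ⊗ (antipode a1 * v1 * a3))].

Definition crossed_module_map V W (rV : V -> A -> V) (DV : V -> V ⊗ A)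
    (rW : W -> A -> W) (DW : W -> W ⊗ A) (f : V -> W) : Prop :=
  right_module_map rV rW f /\ right_comodule_map DV DW f.

End Modules.

Section Augmentation.
Variables (k : fieldType) (A : hopfAlgType k).

Definition in_aug : {pred A} := fun a => counit a == 0.

Fact in_aug_submod : submod_closed in_aug.
Proof.
split=> [|c x y]; rewrite !unfold_in ?linear0 // => /eqP hx /eqP hy.
by rewrite linearP /= hx hy mulr0 addr0.
Qed.

HB.instance Definition _ := GRing.isSubmodClosed.Build k A in_aug in_aug_submod.

Record aug := Aug { aug_val : A; _ : aug_val \in in_aug }.

HB.instance Definition _ := [isSub for aug_val].
HB.instance Definition _ := [Choice of aug by <:].
HB.instance Definition _ := [SubChoice_isSubLmodule of aug by <:].

Fact aug_proj_subproof (a : A) : a - counit a *: 1 \in in_aug.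
Proof. by rewrite unfold_in linearB linearZ /= counit1 mulr1 subrr. Qed.

Definition aug_proj (a : A) : aug := Aug (aug_proj_subproof a).

Fact aug_act_subproof (a : aug) (b : A) : val a * b \in in_aug.
Proof.
by case: a => a /= ha; rewrite unfold_in counitM (eqP ha) mul0r.
Qed.

Definition aug_act (a : aug) (b : A) : aug := Aug (aug_act_subproof a b).

Definition adjoint_coact (a : A) : A ⊗ A :=
  \tlift_(a1, a' <- comul a) \tlift_(a2, a3 <- comul a')
    (a2 ⊗ (antipode a1 * a3)).

(* On A^+ the adjoint coaction takes values in A^+ ⊗ A, on which the
   projection aug_proj ⊗ id is the identity; see aug_coactE. *)
Definition aug_coact (a : aug) : aug ⊗ A :=
  tmap aug_proj id (adjoint_coact (val a)).

Fact aug_proj_linear : linear aug_proj.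
Proof.
move=> c a b; apply: val_inj; rewrite /= linearP /=.
by rewrite scalerDl scalerBr opprD addrACA scalerA.
Qed.

HB.instance Definition _ :=
  GRing.isLinear.Build k A aug *:%R aug_proj aug_proj_linear.

Lemma aug_coactE (a : aug) :
  tmap val id (aug_coact a) = adjoint_coact (val a).
Proof.
pose L t := tmap (val : aug -> A) (@id A) (tmap aug_proj id t).
have linL : linear L.
  by move=> c x y; rewrite /L (tmap_linear aug_proj idfun) (tmap_linear val idfun).
have LE b c : L (b ⊗ c) = b ⊗ c - 1 ⊗ (counit b *: c).
  rewrite /L (tmap_tens aug_proj idfun) (tmap_tens val idfun) /=.
  have := (tens_bilinear A A).1 c (- counit b) 1 b => /= h.
  have := (tens_bilinear A A).2 1 (counit b) c 0 => /= h'.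
  have e0 : (1 : A) ⊗ (0 : A) = 0.
    have := (tens_bilinear A A).2 1 (- 1) 0 0 => /=.
    by rewrite scaler0 addr0 scaleN1r addNr.
  by rewrite addrC -scaleNr h; move: h'; rewrite !addr0 e0 addr0 => ->;
    rewrite scaleNr addrC.
rewrite -[LHS]/(L (adjoint_coact (val a))) /adjoint_coact.
rewrite (linear_tlift _ _ linL).
under eq_tlift => a1 a'.
  rewrite (linear_tlift _ _ linL).
  under eq_tlift => a2 a3 do rewrite LE.
  rewrite tliftB.
  have lh : linear (fun x : A => (1 : A) ⊗ (antipode a1 * x)).
    move=> c x y; rewrite mulrDr -scalerAr.
    exact: (tens_bilinear A A).2.
  have -> : \tlift_(a2, a3 <- comul a') (1 ⊗ (counit a2 *: (antipode a1 * a3)))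
      = (1 : A) ⊗ (antipode a1 * a').
    rewrite -[in RHS](comul_counitl a') (linear_tlift _ _ lh).
    by apply: eq_tlift => a2 a3; rewrite -scalerAr.
  over.
rewrite tliftB.
have l1 : linear (fun x : A => (1 : A) ⊗ x).
  by move=> c x y; apply: (tens_bilinear A A).2.
rewrite -(linear_tlift _ _ l1) antipodel.
have /eqP -> : counit (val a) == 0 by apply: (valP a).
rewrite scale0r.
have -> : (1 : A) ⊗ (0 : A) = 0.
  have := l1 (- 1) 0 0; by rewrite scaler0 addr0 scaleN1r addNr.
by rewrite subr0.
Qed.

End Augmentation.

Section Calculi.
Variables (k : fieldType) (A : hopfAlgType k).

(* Operations only; the axioms are is_calculus, left_covariant, bicovariant. *)
Record precalculus := Precalculus {
  forms : lmodType k;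
  lact : A -> forms -> forms;
  ract : forms -> A -> forms;
  der : A -> forms
}.

Record left_precalculus := LeftPrecalculus {
  left_base :> precalculus;
  coactL : forms left_base -> A ⊗ forms left_base
}.

Record bi_precalculus := BiPrecalculus {
  bi_base :> left_precalculus;
  coactR : forms bi_base -> forms bi_base ⊗ A
}.

Definition is_calculus (X : precalculus) : Prop :=
  [/\ bimodule (@lact X) (@ract X), linear (@der X)
    & forall a b, der X (a * b) = ract (der X a) b + lact a (der X b)].

Definition coactL_covariant (X : left_precalculus) : Prop :=
  bimodule_map (@lact X) (@ract X)
    (tensor_lact *%R (@lact X)) (tensor_ract *%R (@ract X)) (@coactL X)
  /\ left_comodule_map comul (@coactL X) (@der X).

Definition coactR_covariant (X : bi_precalculus) : Prop :=
  bimodule_map (@lact X) (@ract X)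
    (tensor_lact (@lact X) *%R) (tensor_ract (@ract X) *%R) (@coactR X)
  /\ right_comodule_map comul (@coactR X) (@der X).

Definition left_covariant (X : left_precalculus) : Prop :=
  [/\ is_calculus X, left_comodule (@coactL X) & coactL_covariant X].

Definition bicovariant (X : bi_precalculus) : Prop :=
  [/\ is_calculus X, bicomodule (@coactL X) (@coactR X),
      coactL_covariant X & coactR_covariant X].

Definition calculus_map (X Y : precalculus) (f : forms X -> forms Y) : Prop :=
  bimodule_map (@lact X) (@ract X) (@lact Y) (@ract Y) f
  /\ forall a, f (der X a) = der Y a.

Definition left_calculus_map (X Y : left_precalculus) (f : forms X -> forms Y)
    : Prop :=
  calculus_map f /\ left_comodule_map (@coactL X) (@coactL Y) f.

Definition bi_calculus_map (X Y : bi_precalculus) (f : forms X -> forms Y)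
    : Prop :=
  left_calculus_map f /\ right_comodule_map (@coactR X) (@coactR Y) f.

Definition left_calculus_iso (X Y : left_precalculus) : Prop :=
  exists f : forms X -> forms Y, left_calculus_map f /\ bijective f.

Definition bi_calculus_iso (X Y : bi_precalculus) : Prop :=
  exists f : forms X -> forms Y, bi_calculus_map f /\ bijective f.

Definition phi (X : precalculus) (t : A ⊗ A) : forms X :=
  \tlift_(a, b <- t) lact a (der X b).

Definition standard_form (X : precalculus) (x : forms X) : Prop :=
  exists t : A ⊗ A, x = phi X t.

(* f identifies Y with the sub-calculus of X whose forms are phi (A ⊗ A). *)
Definition standard_subcalculus (X Y : precalculus) (f : forms Y -> forms X)
    : Prop :=
  [/\ calculus_map f, injective f
    & forall x : forms X, standard_form x <-> exists y, f y = x].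

Section FromData.
Variables (L : lmodType k) (r : L -> A -> L) (D : L -> L ⊗ A).
Variable omega : {linear aug A -> L}.

Definition data_precalculus : precalculus := {|
  forms := (A ⊗ L)%type;
  lact := fun a => tmap (fun b : A => a * b) id;
  ract := tensor_ract *%R r;
  der := fun a => tmap id (fun b => omega (aug_proj b)) (comul a)
|}.

Definition data_left : left_precalculus := {|
  left_base := data_precalculus;
  coactL := fun t : A ⊗ L => tassoc (tmap comul id t)
|}.

Definition data_bi : bi_precalculus := {|
  bi_base := data_left;
  coactR := fun t : A ⊗ L =>
    \tlift_(a, v <- t) \tlift_(a1, a2 <- comul a) \tlift_(v0, v1 <- D v)
      ((a1 ⊗ v0) ⊗ (a2 * v1))
|}.

Definition left_data : Prop :=
  right_module r /\ right_module_map (@aug_act k A) r omega.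

Definition bi_data : Prop :=
  crossed_module r D
  /\ crossed_module_map (@aug_act k A) (@aug_coact k A) r D omega.

End FromData.
End Calculi.

(* Main.v *)
(* The projection [P x = S(x_(-1)) . x_(0)] of a left covariant bimodule maps
   onto the left coinvariant forms, and every form is recovered as
   [x = x_(-1) . P(x_(0))]; so [x |-> x_(-1) ⊗ P(x_(0))] identifies the calculus
   with the free left module on [Λ = im P], on which [v ◁ b = P(v b)] and
   [ω(a) = P(d a)].
   Throughout, an identity containing the antipode is replaced by its
   antipode-free equivalent: for a left comodule [X], a left module [V] and a
   linear [F : X -> V], one has [F x = S(x_(-1)) . G(x_(0))] as soon as
   [G x = x_(-1) . F(x_(0))], and conversely. Applied to [V = A ⊗ X] this gives
   the coinvariance of [P x], and applied to [V = Λ ⊗ A] it turns the crossed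
   module condition into [(v ◁ a_(2))_0 ⊗ a_(1) (v ◁ a_(2))_1
   = v_0 ◁ a_(1) ⊗ v_1 a_(2)], and colinearity of [ω] into the analogous
   identity; neither antimultiplicativity nor anticomultiplicativity of [S] is
   needed. *)
Require Import Defs.
From HB Require Import structures.
From mathcomp Require Import all_boot all_order all_algebra.
From mathcomp Require Import boolp classical_sets.
Set Implicit Arguments.
Unset Strict Implicit.
Unset Printing Implicit Defensive.
Import GRing.Theory.
Local Open Scope ring_scope.

(* [linear] and [bilinear_map] allow a codomain that is only a Zmodule; these
   variants keep an lmodType there, which [linearity] below relies on when it
   recognises linear expressions by their syntactic shape. *)
Definition lin (k : fieldType) (V W : lmodType k) (f : V -> W) : Prop :=
  forall c x y, f (c *: x + y) = c *: f x + f y.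

Definition bilin (k : fieldType) (U V W : lmodType k) (f : U -> V -> W) : Prop :=
  (forall v, lin (fun u => f u v)) /\ (forall u, lin (f u)).

(** * Multilinear calculus on tensor products *)

Section Linearity.
Variable k : fieldType.
Implicit Types U V W X : lmodType k.

Lemma lin_id V : lin (fun x : V => x).
Proof. by []. Qed.

Lemma lin0 V W (f : V -> W) : lin f -> f 0 = 0.
Proof. by move=> lf; have := lf (- 1) 0 0; rewrite !scaleN1r !addNr. Qed.

Lemma linZ V W (f : V -> W) c x : lin f -> f (c *: x) = c *: f x.
Proof. by move=> lf; have := lf c x 0; rewrite (lin0 lf) !addr0. Qed.

Lemma lin_comp U V W (g : V -> W) (f : U -> V) :
  lin g -> lin f -> lin (fun x => g (f x)).
Proof. by move=> lg lf c x y; rewrite lf lg. Qed.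

Lemma bilin_compl U V W X (b : U -> V -> W) (f : X -> U) v :
  bilin b -> lin f -> lin (fun x => b (f x) v).
Proof. by move=> lb lf c x y; rewrite lf lb.1. Qed.

Lemma bilin_compr U V W X (b : U -> V -> W) u (f : X -> V) :
  bilin b -> lin f -> lin (fun x => b u (f x)).
Proof. by move=> lb lf c x y; rewrite lf lb.2. Qed.

Lemma bilin_tens V W : bilin (@tens k V W).
Proof.
split=> [w c v v' | v c w w']; first exact: (tens_bilinear V W).1.
exact: (tens_bilinear V W).2.
Qed.

Lemma lin_scale U V (c : k) (f : U -> V) : lin f -> lin (fun x => c *: f x).
Proof. by move=> lf d x y; rewrite lf scalerDr !scalerA mulrC. Qed.

Lemma tensZl V W c (v : V) (w : W) : (c *: v) ⊗ w = c *: (v ⊗ w).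
Proof. by rewrite (linZ _ _ ((bilin_tens V W).1 w)). Qed.

Lemma tensZr V W c (v : V) (w : W) : v ⊗ (c *: w) = c *: (v ⊗ w).
Proof. by rewrite (linZ _ _ ((bilin_tens V W).2 v)). Qed.

Lemma bilinP U V W (f : U -> V -> W) : bilin f -> bilinear_map f.
Proof. by case=> h1 h2; split=> [v c x y|u c x y]; [apply: h1 | apply: h2]. Qed.

Lemma bilinI U V W (f : U -> V -> W) : bilinear_map f -> bilin f.
Proof. by case=> h1 h2; split=> [v c x y|u c x y]; [apply: h1 | apply: h2]. Qed.

Lemma lin_tlift U V W X (f : U -> V -> W) (t : X -> U ⊗ V) :
  bilin f -> lin t -> lin (fun x => tlift f (t x)).
Proof. by move=> /bilinP bf lt c x y; rewrite lt; apply: tliftP. Qed.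

Lemma lin_tlift_body U V W X (f : X -> U -> V -> W) (t : U ⊗ V) :
  (forall u v, lin (fun x => f x u v)) -> lin (fun x => tlift (f x) t).
Proof.
move=> lf c x y; rewrite /tlift /formal_eval scaler_sumr -big_split /=.
by apply: eq_bigr => p _; rewrite lf.
Qed.

Lemma tlift_pure U V W (f : U -> V -> W) u v :
  bilin f -> tlift f (u ⊗ v) = f u v.
Proof. by move=> /bilinP bf; rewrite tlift_tens. Qed.

Lemma lin_pull U V W X (g : W -> X) (f : U -> V -> W) t :
  lin g -> g (tlift f t) = tlift (fun u v => g (f u v)) t.
Proof. by move=> lg; rewrite linear_tlift. Qed.

Lemma tlift_swap U V U' V' W (f : U -> V -> U' -> V' -> W) (t : U ⊗ V) (t' : U' ⊗ V') :
  tlift (fun u v => tlift (fun u' v' => f u v u' v') t') t =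
  tlift (fun u' v' => tlift (fun u v => f u v u' v') t) t'.
Proof. exact: exchange_big. Qed.

Lemma tlift_id U V (t : U ⊗ V) : tlift (fun u v => u ⊗ v) t = t.
Proof. by rewrite [RHS]tens_sum. Qed.

Lemma tliftD U V W (f g : U -> V -> W) t :
  tlift (fun u v => f u v + g u v) t = tlift f t + tlift g t.
Proof. exact: big_split. Qed.

End Linearity.

Section HopfLin.
Variables (k : fieldType) (A : hopfAlgType k).

Lemma lin_comul : lin (@comul k A). Proof. exact: comul_linear. Qed.
Lemma lin_antipode : lin (@antipode k A). Proof. exact: antipode_linear. Qed.
Lemma bilin_mul : bilin (fun a b : A => a * b).
Proof.
split=> b c x y; first by rewrite mulrDl -scalerAl.
by rewrite mulrDr -scalerAr.
Qed.
Lemma lin_counit (U V : lmodType k) (f : U -> A) (v : V) :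
  lin f -> lin (fun x => counit (f x) *: v).
Proof. by move=> lf c x y; rewrite lf linearP /= scalerDl scalerA. Qed.
End HopfLin.

Lemma linear_lin (k : fieldType) (V W : lmodType k) (f : {linear V -> W}) : lin f.
Proof. by move=> c x y; rewrite linearP. Qed.

Lemma linP (k : fieldType) (V W : lmodType k) (f : V -> W) : lin f -> linear f.
Proof. by []. Qed.

(** Shape used by [sweedler]: both sides are replaced by expanded forms, and only the equation
    between these remains. *)
Lemma eq_eq_trans T (a b a' b' : T) : a = a' -> b = b' -> a' = b' -> a = b.
Proof. by move=> -> ->. Qed.

(** The known equation [b = c] comes first, so that [a] and [d] can then be expanded to match its
    two sides. *)
Lemma eq_through T (a b c d : T) : b = c -> a = b -> c = d -> a = d.
Proof. by move=> -> ->. Qed.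

(** * Automation for linearity and Sweedler calculations *)

Ltac by_hyp := match goal with H : _ |- _ => solve [simple apply H] end.
Ltac split_bilin g h b :=
  lazymatch h with
  | (fun _ => ?w) => apply (@bilin_compl _ _ _ _ _ _ g w b)
  | _ => lazymatch g with
    | (fun _ => ?w) => apply (@bilin_compr _ _ _ _ _ _ w h b)
    end
  end.
Ltac lin_step :=
  lazymatch goal with
  | |- bilin _ => first [ by_hyp | split; [intros ? | intros ?] ]
  | |- forall _, _ => intros ?
  | |- @lin _ ?V _ ?f =>
    first
    [ by_hyp
    | change (lin (fun x : V => f x)); cbv beta;
      lazymatch goal with
      | |- lin (fun x => x) => exact: lin_id
      | |- lin (fun x => tens (@?g x) (@?h x)) => split_bilin g h uconstr:(bilin_tens _ _)
      | |- lin (fun x => (@?g x) * (@?h x)) => split_bilin g h uconstr:(bilin_mul _)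
      | |- lin (fun x => tlift (@?g x) (@?h x)) =>
        lazymatch h with
        | (fun _ => ?w) => apply (@lin_tlift_body _ _ _ _ _ g w)
        | _ => lazymatch g with
          | (fun _ => ?w) => apply (@lin_tlift _ _ _ _ _ w h)
          end
        end
      | |- lin (fun x => comul (@?g x)) => apply (@lin_comp _ _ _ _ _ g (@lin_comul _ _))
      | |- lin (fun x => antipode (@?g x)) => apply (@lin_comp _ _ _ _ _ g (@lin_antipode _ _))
      | |- lin (fun x => counit (@?g x) *: (@?h x)) =>
        lazymatch h with
        | (fun _ => ?v) => apply (@lin_counit _ _ _ _ g v)
        | _ => lazymatch g with
          | (fun _ => ?a) => apply (@lin_scale _ _ _ (counit a) h)
          end
        end
      | _ =>
        match goal with
        | H : lin ?h |- lin (fun x => ?h (@?g x)) => apply (@lin_comp _ _ _ _ _ g H)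
        | H : bilin ?b |- lin (fun x => ?b (@?g x) (@?h x)) => split_bilin g h H
        | |- lin (fun x => ?h (@?g x)) => apply (@lin_comp _ _ _ _ _ g (linear_lin h))
        end
      end ]
  end.
Ltac linearity := cbv beta; repeat lin_step.

(* Solves [E = ?r] by instantiating [?r] with E rewritten as nested [tlift]s over
   atomic tensors: inner [tlift]s are pulled out by linearity, [tlift] is
   evaluated on pure tensors, and [tac] rewrites the innermost expressions. The
   nesting follows the order of occurrence, so equal terms are usually
   syntactically equal afterwards up to swapping binders. *)
Ltac expand tac :=
  cbv beta;
  lazymatch goal with
  | |- @tlift ?k ?V ?W ?U ?f ?t = _ =>
    etransitivity; [ eapply (f_equal (@tlift k V W U f)); expand tac | cbv beta ];
    lazymatch goal with
    | |- tlift _ (tens ?u ?v) = _ =>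
       etransitivity; [ eapply (@tlift_pure k V W U f u v); solve [linearity] | expand tac ]
    | |- tlift _ (@tlift _ ?V' ?W' _ ?g ?s) = _ =>
       etransitivity;
         [ eapply (@lin_pull k V' W' _ _ (@tlift k V W U f) g s); solve [linearity]
         | expand tac ]
    | |- _ => eapply (@eq_tlift k V W U f); intros ? ?; expand tac
    end
  | |- ?E = _ =>
    lazymatch E with
    | context [@tlift ?k ?V ?W ?U ?f ?t] =>
      lazymatch eval pattern (@tlift k V W U f t) in E with
      | ?G _ =>
        etransitivity; [ eapply (@lin_pull k V W _ _ G f t); solve [linearity]
                       | expand tac ]
      end
    | _ => tryif tac then expand tac else reflexivity
    end
  end.

Tactic Notation "sweedler" :=
  eapply eq_eq_trans; [expand fail | expand fail | cbv beta].
Tactic Notation "sweedler" tactic0(tac) :=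
  eapply eq_eq_trans; [expand tac | expand tac | cbv beta].
Tactic Notation "sweedler_lhs" :=
  etransitivity; [expand fail | cbv beta].
Tactic Notation "sweedler_lhs" tactic0(tac) :=
  etransitivity; [expand tac | cbv beta].
Ltac unfold_tensor := rewrite /tensor_lact /tensor_ract /tact /tassoc /tmap.

Definition trilin (k : fieldType) (U V W X : lmodType k) (f : U -> V -> W -> X) : Prop :=
  [/\ forall v w, lin (fun u => f u v w), forall u w, lin (fun v => f u v w)
    & forall u v, lin (f u v)].

Section Coassoc.
Variable k : fieldType.
Implicit Types U V W X Y Z : lmodType k.

(** Coassociativity inside a trilinear expression. Keeping [g], [h], [t], [t'] independent covers at
    once the coproduct, left and right comodules, and the commutation of a left with a right
    coaction, where [t] and [t'] differ. *)
Lemma tlift_coassoc U V W X Y Z (g : X -> U ⊗ V) (h : Y -> V ⊗ W)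
    (f : U -> V -> W -> Z) t t' :
  tassoc (tmap g id t) = tmap id h t' -> lin g -> lin h -> trilin f ->
  \tlift_(x, w <- t) \tlift_(u, v <- g x) f u v w =
  \tlift_(u, y <- t') \tlift_(v, w <- h y) f u v w.
Proof.
move=> /(congr1 (tlift (fun u => tlift (f u)))); unfold_tensor => e lg lh [l1 l2 l3].
have b u : bilin (f u) by linearity.
have b' : bilin (fun u => tlift (f u)) by linearity.
by apply: (eq_through e); sweedler.
Qed.
End Coassoc.

Ltac coassoc H :=
  etransitivity;
    [ eapply (tlift_coassoc H); [ | | split ]; solve [linearity] | cbv beta ].
(** Brings the two stages of an iterated coaction next to each other, as [coassoc] requires. *)
Ltac swap_in :=
  etransitivity; [apply: eq_tlift => ? ?; exact: tlift_swap | cbv beta].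

(** * Hopf algebra identities *)

Section Hopf.
Variables (k : fieldType) (A : hopfAlgType k).
Implicit Types (U V W X : lmodType k) (a b : A).

Lemma comulME a b : comul (a * b) =
  \tlift_(a1, a2 <- comul a) \tlift_(b1, b2 <- comul b) ((a1 * b1) ⊗ (a2 * b2)).
Proof. by rewrite comulM; unfold_tensor; sweedler. Qed.

Lemma antipodel_lin V (f : A -> V) a : lin f ->
  \tlift_(a1, a2 <- comul a) f (antipode a1 * a2) = counit a *: f 1.
Proof.
by move=> lf; rewrite -(lin_pull _ _ lf) antipodel linZ.
Qed.

Lemma antipoder_lin V (f : A -> V) a : lin f ->
  \tlift_(a1, a2 <- comul a) f (a1 * antipode a2) = counit a *: f 1.
Proof.
by move=> lf; rewrite -(lin_pull _ _ lf) antipoder linZ.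
Qed.

Lemma counitl_lin V (f : A -> V) a : lin f ->
  \tlift_(a1, a2 <- comul a) (counit a1 *: f a2) = f a.
Proof.
move=> lf; rewrite -[in RHS](comul_counitl a) (lin_pull _ _ lf).
by apply: eq_tlift => a1 a2; rewrite linZ.
Qed.

Lemma counitr_lin V (f : A -> V) a : lin f ->
  \tlift_(a1, a2 <- comul a) (counit a2 *: f a1) = f a.
Proof.
move=> lf; rewrite -[in RHS](comul_counitr a) (lin_pull _ _ lf).
by apply: eq_tlift => a1 a2; rewrite linZ.
Qed.

Lemma antipode1 : antipode (1 : A) = 1.
Proof.
have := antipodel (1 : A); rewrite comul1 tlift_pure; last first.
  by split=> a; linearity.
by rewrite mulr1 counit1 scale1r.
Qed.

(** Source of the Leibniz rule: the two terms become [(d a) b] and [a (d b)]. *)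
Lemma aug_projM (a b : A) :
  aug_proj (a * b) = aug_act (aug_proj a) b + counit a *: aug_proj b.
Proof.
apply: val_inj; rewrite /= counitM mulrBl -scalerAl mul1r scalerBr scalerA.
by rewrite addrA subrK.
Qed.

Lemma aug_projK (x : aug A) : aug_proj (val x) = x.
Proof.
apply: val_inj => /=; have /eqP -> : counit (val x) == 0 by exact: (valP x).
by rewrite scale0r subr0.
Qed.

Lemma aug_proj1 : aug_proj (1 : A) = 0.
Proof. by apply: val_inj; rewrite /= counit1 scale1r subrr. Qed.

End Hopf.

(** * Inversion by the antipode, and module structures on tensor products *)

Section HopfModules.
Variables (k : fieldType) (A : hopfAlgType k).
Implicit Types (U V W X : lmodType k) (a b : A).

Lemma left_counit_lin X V (D : X -> (A ⊗ X)%type) (F : X -> V) x :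
  left_comodule D -> lin F -> \tlift_(a, y <- D x) (counit a *: F y) = F x.
Proof.
case=> _ _ eD lF; rewrite -[in RHS](eD x) (lin_pull _ _ lF).
by apply: eq_tlift => a y; rewrite linZ.
Qed.

Lemma right_counit_lin X V (D : X -> (X ⊗ A)%type) (F : X -> V) x :
  right_comodule D -> lin F -> \tlift_(y, a <- D x) (counit a *: F y) = F x.
Proof.
case=> _ _ eD lF; rewrite -[in RHS](eD x) (lin_pull _ _ lF).
by apply: eq_tlift => a y; rewrite linZ.
Qed.

Lemma left_comodule_comul : left_comodule (@comul k A).
Proof. by split; [exact: comul_linear | exact: comulA | exact: comul_counitl]. Qed.

Section Inversion.
Variables (X V : lmodType k) (D : X -> (A ⊗ X)%type) (l : A -> V -> V) (F : X -> V).
Hypotheses (hD : left_comodule D) (hl : left_module l) (lF : lin F).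

(** Coassociativity brings the antipode next to its partner leg, and the antipode axiom leaves a
    counit. Together with [antipode_cancelr] this makes [F |-> x_(-1) . F(x_(0))] a bijection on
    linear maps from [X] to [V]. *)
Lemma antipode_cancell x :
  \tlift_(a, y <- D x) l (antipode a) (\tlift_(b, z <- D y) l b (F z)) = F x.
Proof.
have [/bilinI bl l1 lM] := hl; have lD : lin D by case: hD.
sweedler (rewrite -lM).
rewrite -(tlift_coassoc (g := comul) (t := D x)); last by split; linearity.
- rewrite -(left_counit_lin x hD lF); apply: eq_tlift => a y.
  by rewrite (antipodel_lin (f := fun b => l b (F y))) ?l1 //; linearity.
- by case: hD.
- by linearity.
- by linearity.
Qed.

Lemma antipode_cancelr x :
  \tlift_(a, y <- D x) l a (\tlift_(b, z <- D y) l (antipode b) (F z)) = F x.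
Proof.
have [/bilinI bl l1 lM] := hl; have lD : lin D by case: hD.
sweedler (rewrite -lM).
rewrite -(tlift_coassoc (g := comul) (t := D x)); last by split; linearity.
- rewrite -(left_counit_lin x hD lF); apply: eq_tlift => a y.
  by rewrite (antipoder_lin (f := fun b => l b (F y))) ?l1 //; linearity.
- by case: hD.
- by linearity.
- by linearity.
Qed.
End Inversion.

Lemma mul_left_module : left_module (fun a b : A => a * b).
Proof.
split=> [|a|a b c]; [exact/bilinP/bilin_mul | exact: mul1r | by rewrite mulrA].
Qed.

Lemma mul_right_module : right_module (fun a b : A => a * b).
Proof.
split=> [|a|a b c]; [exact/bilinP/bilin_mul | exact: mulr1 | by rewrite mulrA].
Qed.

(** The module [V ⊗ A] to which the inversion is applied in the crossed module conditions. *)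
Lemma tmapr_left_module V :
  left_module (fun (b : A) (t : (V ⊗ A)%type) => tmap id (fun c => b * c) t).
Proof.
split=> [|t|a b t].
- by apply: bilinP; unfold_tensor; linearity.
- by rewrite -[RHS]tlift_id; unfold_tensor; apply: eq_tlift => v a; rewrite mul1r.
- by unfold_tensor; sweedler; apply: eq_tlift => v c; rewrite mulrA.
Qed.

Lemma tensor_lact_module V W (lV : A -> V -> V) (lW : A -> W -> W) :
  left_module lV -> left_module lW -> left_module (tensor_lact lV lW).
Proof.
move=> [/bilinI bV V1 VM] [/bilinI bW W1 WM]; split.
- by apply: bilinP; unfold_tensor; linearity.
- move=> t; unfold_tensor; rewrite comul1 tlift_pure; last by linearity.
  by rewrite -[RHS]tlift_id; apply: eq_tlift => v w; rewrite V1 W1.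
- move=> a b t; unfold_tensor; sweedler (rewrite comulME).
  by do 3 apply: eq_tlift => ? ?; rewrite VM WM.
Qed.

Lemma tensor_ract_module V W (rV : V -> A -> V) (rW : W -> A -> W) :
  right_module rV -> right_module rW -> right_module (tensor_ract rV rW).
Proof.
move=> [/bilinI bV V1 VM] [/bilinI bW W1 WM]; split.
- by apply: bilinP; unfold_tensor; linearity.
- move=> t; unfold_tensor; rewrite comul1 tlift_pure; last by linearity.
  by rewrite -[RHS]tlift_id; apply: eq_tlift => v w; rewrite V1 W1.
- move=> t a b; unfold_tensor; sweedler (rewrite comulME).
  by rewrite tlift_swap; do 3 apply: eq_tlift => ? ?; rewrite VM WM.
Qed.

End HopfModules.

(** * Calculi from data *)

Section Data.
Variables (k : fieldType) (A : hopfAlgType k).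
Variables (L : lmodType k) (r : L -> A -> L) (omega : {linear aug A -> L}).
Hypothesis hd : left_data r omega.

Lemma data_is_calculus : is_calculus (data_precalculus r omega).
Proof.
have [hr [lo oM]] := hd; have [/bilinI br r1 rM] := hr.
split=> /=.
- split.
  + split=> [|t|a b t].
    * by apply: bilinP; unfold_tensor; linearity.
    * by rewrite -[RHS]tlift_id; unfold_tensor; apply: eq_tlift => a v; rewrite mul1r.
    * by unfold_tensor; sweedler; apply: eq_tlift => x v; rewrite mulrA.
  + exact: tensor_ract_module (mul_right_module A) hr.
  + move=> a t b; unfold_tensor; sweedler.
    by do 2 apply: eq_tlift => ? ?; rewrite mulrA.
- by apply: linP; unfold_tensor; linearity.
- move=> a b; unfold_tensor.
  (* The two sums arise from [aug_projM] applied to [a_(2) b_(2)]; they are [(d a) b] and [a (d b)]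
     respectively, the latter after a counit collapses. *)
  transitivity (
    \tlift_(a1, a2 <- comul a) \tlift_(b1, b2 <- comul b)
      ((a1 * b1) ⊗ r (omega (aug_proj a2)) b2) +
    \tlift_(a1, a2 <- comul a) \tlift_(b1, b2 <- comul b)
      (counit a2 *: ((a1 * b1) ⊗ omega (aug_proj b2)))).
    rewrite comulME -tliftD; sweedler_lhs.
    apply: eq_tlift => a1 a2; rewrite -tliftD; apply: eq_tlift => b1 b2.
    rewrite aug_projM addrC lo oM.
    by rewrite (bilin_tens _ _).2 addrC.
  congr (_ + _); sweedler.
    by rewrite tlift_swap.
  rewrite tlift_swap; apply: eq_tlift => b1 b2.
  rewrite (counitr_lin (f := fun x => (x * b1) ⊗ omega (aug_proj b2))) //.
  by linearity.
Qed.

Lemma data_left_covariant : left_covariant (data_left r omega).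
Proof.
have [hr [lo oM]] := hd; have [/bilinI br r1 rM] := hr.
split; first exact: data_is_calculus.
- split=> /=.
  + by apply: linP; unfold_tensor; linearity.
  + move=> t; unfold_tensor; sweedler.
    by apply: eq_tlift => a v; coassoc (comulA a).
  + move=> t; rewrite -[RHS]tlift_id; unfold_tensor; sweedler.
    apply: eq_tlift => a v; rewrite (counitl_lin (f := fun x => x ⊗ v)) //.
    by linearity.
- split=> /=.
  + split; split=> /=.
    * by apply: linP; unfold_tensor; linearity.
    * by move=> a t; unfold_tensor; sweedler (rewrite comulME); rewrite tlift_swap.
    * by apply: linP; unfold_tensor; linearity.
    * move=> t a; unfold_tensor; sweedler (rewrite comulME).
      rewrite tlift_swap [RHS]tlift_swap; apply: eq_tlift => x v.
      rewrite tlift_swap [RHS]tlift_swap; apply: eq_tlift => x1 x2.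
      by coassoc (comulA a).
  + split; first by case: data_is_calculus.
    move=> a; unfold_tensor; sweedler.
    by coassoc (comulA a).
Qed.
End Data.

(** * Antipode-free forms of the crossed module conditions *)

Section Crossed.
Variables (k : fieldType) (A : hopfAlgType k).
Variables (L : lmodType k) (r : L -> A -> L) (D : L -> (L ⊗ A)%type).
Hypotheses (hr : right_module r) (lD : lin D).

Lemma crossed_condP :
  (forall v a, D (r v a) = \tlift_(a1, a' <- comul a) \tlift_(a2, a3 <- comul a')
      \tlift_(v0, v1 <- D v) (r v0 a2 ⊗ (antipode a1 * v1 * a3))) <->
  (forall v a, \tlift_(a1, a2 <- comul a) \tlift_(w0, w1 <- D (r v a2)) (w0 ⊗ (a1 * w1)) =
               \tlift_(a1, a2 <- comul a) \tlift_(v0, v1 <- D v) (r v0 a1 ⊗ (v1 * a2))).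
Proof.
have [/bilinI br r1 rM] := hr.
pose F v a := \tlift_(a1, a2 <- comul a) \tlift_(v0, v1 <- D v) (r v0 a1 ⊗ (v1 * a2)).
have lF v : lin (F v) by rewrite /F; linearity.
pose l (b : A) (t : (L ⊗ A)%type) := tmap id (fun c => b * c) t.
have hl : left_module l by exact: tmapr_left_module.
(* The crossed module formula reads [D (v ◁ a) = S(a_(1)) . F v a_(2)], which is the inverted form
   of the second condition. *)
have e v a : \tlift_(a1, a' <- comul a) \tlift_(a2, a3 <- comul a')
      \tlift_(v0, v1 <- D v) (r v0 a2 ⊗ (antipode a1 * v1 * a3)) =
      \tlift_(a1, a' <- comul a) l (antipode a1) (F v a').
  rewrite /l /F; unfold_tensor; sweedler.
  by do 3 apply: eq_tlift => ? ?; rewrite mulrA.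
split=> h v a.
  rewrite -[RHS](antipode_cancelr (left_comodule_comul A) hl (lF v)).
  by apply: eq_tlift => a1 a2; rewrite h e.
have lG : lin (fun a => D (r v a)) by linearity.
rewrite -[LHS](antipode_cancell (left_comodule_comul A) hl lG) e.
by apply: eq_tlift => a1 a2; rewrite -[RHS]/(l (antipode a1) (F v a2)) /F -h.
Qed.

Variable omega : {linear aug A -> L}.

Lemma coact_omegaP :
  (forall x, D (omega x) = tmap omega id (aug_coact x)) <->
  (forall a, \tlift_(a1, a2 <- comul a)
               \tlift_(w0, w1 <- D (omega (aug_proj a2))) (w0 ⊗ (a1 * w1)) =
             \tlift_(a1, a2 <- comul a) (omega (aug_proj a1) ⊗ a2)).
Proof.
have lo := linear_lin omega.
have lop : lin (fun a : A => omega (aug_proj a)) by linearity.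
pose F (a : A) := \tlift_(a1, a2 <- comul a) (omega (aug_proj a1) ⊗ a2).
have lF : lin F by rewrite /F; linearity.
pose l (b : A) (t : (L ⊗ A)%type) := tmap id (fun c => b * c) t.
have hl : left_module l by exact: tmapr_left_module.
pose G a := tmap (fun a => omega (aug_proj a)) id (adjoint_coact a).
have lG : lin G by rewrite /G /adjoint_coact; unfold_tensor; linearity.
(* Since [G] kills 1, it factors through [aug_proj]; an equation on [aug A] can thus be tested on
   all of [A], where the coproduct is available. *)
have G1 : G 1 = 0.
  rewrite /G /adjoint_coact; unfold_tensor; rewrite comul1.
  sweedler_lhs (rewrite comul1).
  by rewrite aug_proj1 (lin0 lo) (lin0 ((bilin_tens _ _).1 _)).
have GE a : G a = \tlift_(a1, a2 <- comul a) l (antipode a1) (F a2).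
  by rewrite /G /l /F /adjoint_coact; unfold_tensor; sweedler.
have Gval a : G (val (aug_proj a)) = G a.
  by rewrite /= addrC -scaleNr lG G1 scaler0 add0r.
have coactE x : tmap omega id (aug_coact x) = G (val x).
  by rewrite /G /aug_coact /adjoint_coact; unfold_tensor; sweedler.
have lH : lin (fun a => D (omega (aug_proj a))) by linearity.
split=> h.
  move=> a; rewrite -[RHS](antipode_cancelr (left_comodule_comul A) hl lF).
  by apply: eq_tlift => a1 a2; rewrite -GE h coactE Gval.
move=> x; rewrite coactE GE -[in LHS](aug_projK x).
rewrite -[LHS](antipode_cancell (left_comodule_comul A) hl lH).
by apply: eq_tlift => a1 a2; rewrite /F -h.
Qed.
End Crossed.

(** * Bicovariant calculi from crossed module data *)

Section Data.
Variables (k : fieldType) (A : hopfAlgType k).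
Variables (L : lmodType k) (r : L -> A -> L) (D : L -> (L ⊗ A)%type).
Variable omega : {linear aug A -> L}.
Hypothesis hd : bi_data r D omega.

Lemma bi_data_left : left_data r omega.
Proof. by case: hd => [[hr _ _] [ho _]]. Qed.

Lemma data_bicovariant : bicovariant (data_bi r D omega).
Proof.
have [hc hl hcov] := data_left_covariant bi_data_left.
have [[hr hD cD] [[lo oM] [_ oD]]] := hd.
have [/bilinI br r1 rM] := hr.
have [lD' DA De] := hD; have lD : lin D := lD'.
(* In antipode-free form, the two conditions are what compatibility of the right coaction with the
   right action and with [d] needs. *)
have {}cD := (crossed_condP hr lD).1 cD.
have {}oD := (coact_omegaP lD omega).1 oD.
split=> //.
- split; first by [].
  + split=> /=.
    * by apply: linP; linearity.
    * move=> t; unfold_tensor; sweedler (rewrite comulME); apply: eq_tlift => x v.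
      swap_in; coassoc (comulA x); apply: eq_tlift => x1 x'.
      rewrite [LHS]tlift_swap.
      swap_in; coassoc (DA v); apply: eq_tlift => v0 v'.
      by rewrite tlift_swap.
    * move=> t; sweedler_lhs (rewrite counitM mulrC -scalerA).
      rewrite -[RHS]tlift_id; apply: eq_tlift => x v.
      etransitivity.
        apply: eq_tlift => x1 x2.
        eapply (right_counit_lin (F := fun v1 => counit x2 *: (x1 ⊗ v1)) v hD).
        by linearity.
      by rewrite (counitr_lin (f := fun x => x ⊗ v)) //; linearity.
  + move=> t /=; unfold_tensor; sweedler; apply: eq_tlift => x v.
    by swap_in; coassoc (comulA x).
- split=> /=.
  + split; split=> /=.
    * by apply: linP; unfold_tensor; linearity.
    * move=> a t; unfold_tensor; sweedler (rewrite comulME); rewrite tlift_swap.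
      by do 4 apply: eq_tlift => ? ?; rewrite mulrA.
    * by apply: linP; unfold_tensor; linearity.
    * move=> t a; unfold_tensor; sweedler (rewrite comulME).
      rewrite [LHS]tlift_swap [RHS]tlift_swap; apply: eq_tlift => x v.
      rewrite [LHS]tlift_swap [RHS]tlift_swap; apply: eq_tlift => x1 x2.
      (* Coassociativity on both sides splits off [b1], leaving the remaining legs of [a] in [b'],
         to which the crossed condition applies. *)
      coassoc (comulA a); symmetry; swap_in; coassoc (comulA a); symmetry.
      apply: eq_tlift => b1 b'.
      have e := congr1 (tlift (fun w c => ((x1 * b1) ⊗ w) ⊗ (x2 * c))) (cD v b').
      apply: (eq_through e).
        by sweedler; do 2 apply: eq_tlift => ? ?; rewrite mulrA.
      by sweedler; do 2 apply: eq_tlift => ? ?; rewrite mulrA.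
  + split; first by case: hc.
    move=> a; unfold_tensor; sweedler.
    coassoc (comulA a); symmetry; coassoc (comulA a); symmetry.
    apply: eq_tlift => b1 b'.
    have e := congr1 (tlift (fun w c => (b1 ⊗ w) ⊗ c)) (oD b').
    by apply: (eq_through e); sweedler.
Qed.
End Data.

(** * Data from calculi *)

Section LeftCovariant.
Variables (k : fieldType) (A : hopfAlgType k) (M : lmodType k).
Variables (l : A -> M -> M) (r : M -> A -> M) (d : A -> M) (DL : M -> (A ⊗ M)%type).
Let X : left_precalculus A := LeftPrecalculus (left_base := Precalculus l r d) DL.
Hypothesis hX : left_covariant X.

Let hl : left_module l. Proof. by case: hX => [[[]]]. Qed.
Let hr : right_module r. Proof. by case: hX => [[[]]]. Qed.
Let rl a v b : r (l a v) b = l a (r v b). Proof. by case: hX => [[[_ _ ]]]. Qed.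
Let bl : bilin l. Proof. by apply/bilinI; case: hl. Qed.
Let br : bilin r. Proof. by apply/bilinI; case: hr. Qed.
Let ld : lin d. Proof. by case: hX => [[]]. Qed.
Let dM a b : d (a * b) = r (d a) b + l a (d b). Proof. by case: hX => [[_ _]]. Qed.
Let hD : left_comodule DL. Proof. by case: hX. Qed.
Let lD : lin DL. Proof. by case: hD. Qed.
Let DLA x : tassoc (tmap comul id (DL x)) = tmap id DL (DL x).
Proof. by case: hD. Qed.

Let DL_lact a v : DL (l a v) =
  \tlift_(a1, a2 <- comul a) \tlift_(b, y <- DL v) ((a1 * b) ⊗ l a2 y).
Proof.
by case: hX => [_ _ [[[_ h] _] _]]; etransitivity; [exact: h|]; unfold_tensor; sweedler.
Qed.

Let DL_ract v a : DL (r v a) =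
  \tlift_(a1, a2 <- comul a) \tlift_(b, y <- DL v) ((b * a1) ⊗ r y a2).
Proof.
by case: hX => [_ _ [[_ [_ h]] _]]; etransitivity; [exact: h|]; unfold_tensor; sweedler.
Qed.

Let DL_der a : DL (d a) = \tlift_(a1, a2 <- comul a) (a1 ⊗ d a2).
Proof. by case: hX => [_ _ [_ [_ h]]]; exact: h. Qed.

Definition inv_part (x : M) : M := \tlift_(a, y <- DL x) l (antipode a) y.
Notation P := inv_part.

Lemma lin_inv_part : lin P.
Proof. by rewrite /P; linearity. Qed.
Let lP := lin_inv_part.

Lemma inv_part_decomp x : \tlift_(a, y <- DL x) l a (P y) = x.
Proof. exact: (antipode_cancelr hD hl (lin_id (V := M))). Qed.

(* Both sides are the F with [x_(-1) . F(x_(0)) = DL x] for the diagonal action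
   of A on A ⊗ M. *)
Lemma coactL_inv_part x : DL (P x) = 1 ⊗ P x.
Proof.
pose T := tensor_lact *%R l.
have hT : left_module T by exact: tensor_lact_module (mul_left_module A) hl.
have lF : lin (fun x => DL (P x)) by linearity.
have lG : lin (fun x => (1 : A) ⊗ P x) by linearity.
rewrite -[LHS](antipode_cancell hD hT lF) -[RHS](antipode_cancell hD hT lG).
apply: eq_tlift => a y; congr (T _ _); transitivity (DL y).
  rewrite -[in RHS](inv_part_decomp y) (lin_pull _ _ lD).
  by apply: eq_tlift => b z; rewrite DL_lact /T; unfold_tensor; sweedler.
rewrite /T; unfold_tensor; symmetry; sweedler_lhs (rewrite mulr1).
coassoc (DLA y).
rewrite -[RHS]tlift_id; apply: eq_tlift => b y'.
by rewrite -{2}[y'](inv_part_decomp y'); sweedler.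
Qed.

(** For coinvariant [v] the coaction of [a v] is [a_(1) ⊗ a_(2) v], so the antipode axiom
    applies. *)
Lemma inv_part_lact_coinv a v : DL v = 1 ⊗ v -> P (l a v) = counit a *: v.
Proof.
have [_ l1 lM] := hl.
move=> hv; rewrite /P DL_lact hv; sweedler_lhs (rewrite mulr1 -lM).
by rewrite (antipodel_lin (f := fun b => l b v)) ?l1 //; linearity.
Qed.

Lemma inv_part_coinv v : DL v = 1 ⊗ v -> P v = v.
Proof.
have [_ l1 lM] := hl.
by move=> /(inv_part_lact_coinv 1); rewrite l1 counit1 scale1r.
Qed.

(** Reduces to the coinvariant case through [x = x_(-1) P(x_(0))], by multiplicativity of the
    counit. *)
Lemma inv_part_lact a x : P (l a x) = counit a *: P x.
Proof.
have [_ l1 lM] := hl.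
rewrite -{1}[x]inv_part_decomp; sweedler_lhs (rewrite -lM).
etransitivity.
  apply: eq_tlift => b y; rewrite inv_part_lact_coinv; last exact: coactL_inv_part.
  by rewrite counitM -scalerA.
cbv beta; rewrite -(lin_pull _ _ (lin_scale _ (lin_id (V := M)))).
by rewrite (left_counit_lin x hD lP).
Qed.

(** Makes [v ◁ b = P(v b)] an action for which [P] is a right module map. In [x = x_(-1) P(x_(0))]
    the left factor commutes with [b] and [P] turns it into a counit. *)
Lemma inv_part_ract x b : P (r x b) = P (r (P x) b).
Proof.
rewrite -{1}[x]inv_part_decomp; sweedler_lhs (rewrite rl inv_part_lact).
by rewrite (left_counit_lin (F := fun y => P (r (P y) b)) x hD) //; linearity.
Qed.

HB.instance Definition _ := GRing.isLinear.Build k M M *:%R inv_part lin_inv_part.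

(** The left coinvariants, taken as the image of [P] to inherit the subspace structure of
    [lin_image]; [coactL_inv_part] and [inv_part_coinv] identify the two. *)
Definition invariants : lmodType k := lin_image inv_part.
Definition inv_proj : {linear M -> invariants} := to_image inv_part.
Notation pi := inv_proj.

Lemma val_inv_proj x : val (pi x) = P x. Proof. by []. Qed.

Lemma coactL_invariant (v : invariants) : DL (val v) = 1 ⊗ val v.
Proof. by case: v => v hv /=; have /asboolP [u <-] := hv; exact: coactL_inv_part. Qed.

Lemma inv_projK (v : invariants) : pi (val v) = v.
Proof. by apply: val_inj; rewrite val_inv_proj inv_part_coinv // coactL_invariant. Qed.

Lemma inv_proj_lact a x : pi (l a x) = counit a *: pi x.
Proof. by apply: val_inj; rewrite linearZ; exact: inv_part_lact. Qed.

Definition inv_ract (v : invariants) (b : A) : invariants := pi (r (val v) b).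

Lemma inv_proj_ract x b : inv_ract (pi x) b = pi (r x b).
Proof. by apply: val_inj; symmetry; exact: inv_part_ract. Qed.

Definition inv_der (a : aug A) : invariants := pi (d (val a)).

Lemma inv_der_linear : linear inv_der.
Proof. by apply: linP; rewrite /inv_der; linearity. Qed.

HB.instance Definition _ :=
  GRing.isLinear.Build k (aug A) invariants *:%R inv_der inv_der_linear.

Lemma bilin_inv_ract : bilin inv_ract.
Proof.
by rewrite /inv_ract; linearity.
Qed.

Lemma inv_right_module : right_module inv_ract.
Proof.
have [_ r1 rM] := hr; split; first exact/bilinP/bilin_inv_ract.
- by move=> v; rewrite /inv_ract r1 inv_projK.
- by move=> v a b; rewrite -[LHS]/(pi (r (val v) (a * b))) rM -inv_proj_ract.
Qed.

Lemma inv_left_data : left_data inv_ract inv_der.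
Proof.
split; first exact: inv_right_module.
split=> [|a b]; first exact: inv_der_linear.
(* The Leibniz term [a (d b)] projects to [counit a *: pi (d b)], which vanishes on [aug A]. *)
rewrite -[LHS]/(pi (d (val a * b))) dM linearD inv_proj_lact.
have /eqP -> : counit (aug_val a) == 0 by exact: (valP a).
by rewrite scale0r addr0 inv_proj_ract.
Qed.

(** Holds because [d 1 = 0], by the Leibniz rule for the product 1 times 1. *)
Lemma inv_der_proj a : inv_der (aug_proj a) = pi (d a).
Proof.
have [_ r1 _] := hr; have [_ l1 _] := hl.
have d1 : d 1 = 0.
  by have := dM 1 1; rewrite mul1r r1 l1 -[LHS]addr0 => /addrI.
by rewrite /inv_der /= addrC -scaleNr ld d1 scaler0 add0r.
Qed.

Definition to_free (x : M) : (A ⊗ invariants)%type := \tlift_(a, y <- DL x) (a ⊗ pi y).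
Definition of_free (t : (A ⊗ invariants)%type) : M := \tlift_(a, v <- t) l a (val v).

Lemma lin_to_free : lin to_free.
Proof. by rewrite /to_free; linearity. Qed.

Lemma to_freeK : cancel to_free of_free.
Proof.
by move=> x; rewrite -[RHS](inv_part_decomp x) /of_free /to_free; sweedler.
Qed.

(** For coinvariant [v], [DL (a v) = a_(1) ⊗ a_(2) v], and [pi] sends [a_(2) v] to
    [counit a_(2) *: v]. *)
Lemma of_freeK : cancel of_free to_free.
Proof.
move=> t; rewrite -[RHS]tlift_id /of_free /to_free.
sweedler_lhs (first [rewrite DL_lact | rewrite coactL_invariant | rewrite mulr1
                    | rewrite inv_proj_lact inv_projK tensZr]).
apply: eq_tlift => a v.
by rewrite (counitr_lin (f := fun b => b ⊗ v)) //; linearity.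
Qed.

Lemma to_free_map : left_calculus_map (X := X) (Y := data_left inv_ract inv_der) to_free.
Proof.
have bR := bilin_inv_ract.
have lf := lin_to_free.
split; first split.
- split; split=> //.
  + move=> a x; rewrite /to_free /=; unfold_tensor.
    sweedler (first [rewrite DL_lact | rewrite inv_proj_lact tensZr]).
    rewrite tlift_swap; apply: eq_tlift => b y.
    by rewrite (counitr_lin (f := fun a => (a * b) ⊗ pi y)) //; linearity.
  + move=> x a; rewrite /to_free /=; unfold_tensor.
    sweedler (rewrite DL_ract).
    by do 2 apply: eq_tlift => ? ?; rewrite inv_proj_ract.
- move=> a; rewrite /to_free /= DL_der; unfold_tensor.
  by sweedler; apply: eq_tlift => ? ?; rewrite inv_der_proj.
- split=> // x.
  rewrite /to_free /=; unfold_tensor; sweedler.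
  by coassoc (DLA x).
Qed.

Lemma left_covariant_iso : left_calculus_iso X (data_left inv_ract inv_der).
Proof.
exists to_free; split; first exact: to_free_map.
by exists of_free; [exact: to_freeK | exact: of_freeK].
Qed.

(** * The right coaction on the invariants *)

Section Bicovariant.
Variable DR : M -> (M ⊗ A)%type.
Let Y : bi_precalculus A := BiPrecalculus (bi_base := X) DR.
Hypothesis hY : bicovariant Y.

Let hDR : right_comodule DR. Proof. by case: hY => _ []. Qed.
Let lDR : lin DR. Proof. by case: hDR. Qed.
Let DLR x : tassoc (tmap DL id (DR x)) = tmap id DR (DL x).
Proof. by case: hY => _ [_ _ h] _ _; exact: h. Qed.

Let DR_lact a v : DR (l a v) =
  \tlift_(a1, a2 <- comul a) \tlift_(y, b <- DR v) (l a1 y ⊗ (a2 * b)).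
Proof.
by case: hY => [_ _ _ [[[_ h] _] _]]; etransitivity; [exact: h|]; unfold_tensor; sweedler.
Qed.

Let DR_ract v a : DR (r v a) =
  \tlift_(a1, a2 <- comul a) \tlift_(y, b <- DR v) (r y a1 ⊗ (b * a2)).
Proof.
by case: hY => [_ _ _ [[_ [_ h]] _]]; etransitivity; [exact: h|]; unfold_tensor; sweedler.
Qed.

Let DR_der a : DR (d a) = \tlift_(a1, a2 <- comul a) (d a1 ⊗ a2).
Proof. by case: hY => [_ _ _ [_ [_ h]]]; exact: h. Qed.

(** Applying [pi] only serves to land in [invariants ⊗ A]: by [coactR_invariant] it does not change
    the value. *)
Definition inv_coact (v : invariants) : (invariants ⊗ A)%type :=
  \tlift_(y, b <- DR (val v)) (pi y ⊗ b).

Lemma lin_inv_coact : lin inv_coact.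
Proof.
by rewrite /inv_coact; linearity.
Qed.
Let lI := lin_inv_coact.

(** Obtained by applying [DR], then [pi ⊗ id], to [x = x_(-1) P(x_(0))]. It yields the crossed
    condition at [x = v a], colinearity of [inv_der] at [x = d a], and right colinearity of
    [to_free]. *)
Lemma inv_coact_proj x :
  \tlift_(a, y <- DL x) \tlift_(w, b <- inv_coact (pi y)) (w ⊗ (a * b)) =
  \tlift_(y, b <- DR x) (pi y ⊗ b).
Proof.
rewrite -[in RHS](inv_part_decomp x) /inv_coact; symmetry.
sweedler (first [rewrite DR_lact | rewrite inv_proj_lact tensZl]).
apply: eq_tlift => a y; rewrite tlift_swap; apply: eq_tlift => z b.
by rewrite (counitl_lin (f := fun a => pi z ⊗ (a * b))) //; linearity.
Qed.

(* Apply [S(_) . _] to the first two factors of [(DL ⊗ id) DR v = 1 ⊗ DR v]. *)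
Lemma coactR_invariant (v : invariants) :
  \tlift_(w, b <- inv_coact v) (val w ⊗ b) = DR (val v).
Proof.
have := congr1 (tlift (fun a t => \tlift_(y, b <- t) (l (antipode a) y ⊗ b))) (DLR (val v)).
have [_ l1 _] := hl.
rewrite coactL_invariant; unfold_tensor => e.
rewrite /inv_coact; sweedler_lhs.
apply: (eq_through e).
  by symmetry; rewrite /val_inv_proj /=; sweedler_lhs;
    symmetry; rewrite /P; sweedler.
by sweedler_lhs (rewrite antipode1 l1); rewrite tlift_id.
Qed.

Lemma inv_right_comodule : right_comodule inv_coact.
Proof.
have [_ DRA DRe] := hDR.
split; first exact: lI.
- move=> v.
  pose T z := \tlift_(y, c <- DR z) (pi y ⊗ c).
  (* By [coactR_invariant], the second coaction may be computed with [DR] on [DR (val v)], so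
     coassociativity of [DR] applies. *)
  have e := congr1 (tlift (fun z b => T z ⊗ b)) (coactR_invariant v).
  unfold_tensor.
  transitivity (tassoc (\tlift_(y, b <- DR (val v)) (T y ⊗ b))).
    by congr tassoc; rewrite -[RHS]e /T /inv_coact; sweedler.
  unfold_tensor; rewrite /T /inv_coact; sweedler.
  coassoc (DRA (val v)); apply: eq_tlift => y b.
  by rewrite -[in RHS](tlift_id (comul b)); sweedler.
- move=> v; rewrite /inv_coact; sweedler_lhs.
  rewrite (right_counit_lin (F := pi) (val v) hDR); [exact: inv_projK | exact: linear_lin].
Qed.

Lemma inv_bi_data : bi_data inv_ract inv_coact inv_der.
Proof.
have [_ [_ oM]] := inv_left_data.
have bR := bilin_inv_ract.
split.
  split; [exact: inv_right_module | exact: inv_right_comodule|].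
  apply/(crossed_condP inv_right_module lI) => v a.
  have := inv_coact_proj (r (val v) a).
  rewrite DL_ract coactL_invariant DR_ract => e.
  apply: (eq_through e).
    by symmetry; sweedler_lhs (rewrite mul1r).
  by rewrite /inv_coact; sweedler; do 2 apply: eq_tlift => ? ?; rewrite inv_proj_ract.
split; first by split; [exact: inv_der_linear | exact: oM].
split; first exact: inv_der_linear.
apply/(coact_omegaP lI) => a.
have := inv_coact_proj (d a); rewrite DL_der DR_der => e.
apply: (eq_through e).
  by sweedler; apply: eq_tlift => ? ?; rewrite -inv_der_proj.
by sweedler; apply: eq_tlift => ? ?; rewrite -inv_der_proj.
Qed.

Lemma to_free_bi_map :
  bi_calculus_map (X := Y) (Y := data_bi inv_ract inv_coact inv_der) to_free.
Proof.
have lf := lin_to_free.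
split; first exact: to_free_map.
split=> [|x]; first exact: lf.
rewrite /to_free /=; unfold_tensor; sweedler.
(* Coassociativity of [DL] on one side and commutation of [DL] with [DR] on the other leave
   [inv_coact_proj] at [x_(0)]. *)
coassoc (DLA x); symmetry; coassoc (DLR x); symmetry.
apply: eq_tlift => a y.
have e := congr1 (tlift (fun w b => (a ⊗ w) ⊗ b)) (inv_coact_proj y).
by apply: (eq_through e); sweedler.
Qed.

Lemma bicovariant_iso : bi_calculus_iso Y (data_bi inv_ract inv_coact inv_der).
Proof.
exists to_free; split; first exact: to_free_bi_map.
by exists of_free; [exact: to_freeK | exact: of_freeK].
Qed.

End Bicovariant.
End LeftCovariant.

Lemma left_covariant_classification (k : fieldType) (A : hopfAlgType k)
    (X : left_precalculus A) :
  left_covariant X ->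
  exists (L : lmodType k) (r : L -> A -> L) (omega : {linear aug A -> L}),
        left_data r omega /\ left_calculus_iso X (data_left r omega).
Proof.
case: X => [[M l r d] DL] hX.
exists (invariants hX), (inv_ract (hX := hX)), (inv_der hX).
by split; [exact: inv_left_data | exact: left_covariant_iso].
Qed.

Lemma bicovariant_classification (k : fieldType) (A : hopfAlgType k)
    (X : bi_precalculus A) :
  bicovariant X ->
  exists (L : lmodType k) (r : L -> A -> L) (D : L -> L ⊗ A) (omega : {linear aug A -> L}),
        bi_data r D omega /\ bi_calculus_iso X (data_bi r D omega).
Proof.
case: X => [[[M l r d] DL] DR] hY.
have hX : left_covariant (LeftPrecalculus (left_base := Precalculus l r d) DL).
  by case: hY => ? [? _ _] ? _.
exists (invariants hX), (inv_ract (hX := hX)), (inv_coact (hX := hX) DR), (inv_der hX).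
by split; [exact: inv_bi_data | exact: bicovariant_iso].
Qed.

(** * The standard sub-calculus *)

(* A maximal subspace meeting the image of f only in 0 is a complement of it. *)
Lemma lin_image_retraction (k : fieldType) (U V : lmodType k) (f : {linear U -> V}) :
  exists2 p : V -> lin_image f, lin p & forall v, p (val v) = v.
Proof.
pose I v := v \in in_image f.
pose P (W : set V) := (forall c x y, W x -> W y -> W (c *: x + y)) /\
                      (forall x, W x -> I x -> x = 0).
have I0 : I 0 by exact: rpred0.
have IP c x y : I x -> I y -> I (c *: x + y) by move=> ? ?; apply: rpredD => //; apply: rpredZ.
have [W [[WP WI] Wmax]] : exists W, P W /\ forall B, (W `<` B)%classic -> ~ P B.
  apply: Zorn_bigcup => F FP Ftot; split=> [c x y [A FA Ax] [B FB By]|x [A FA Ax]].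
    have [AB|BA] := Ftot _ _ FA FB.
      by exists B => //; apply: (FP _ FB).1 => //; exact: AB.
    by exists A => //; apply: (FP _ FA).1 => //; exact: BA.
  exact: (FP _ FA).2.
(* The empty chain has empty union, so 0 is not in [W] by construction; were it missing, adjoining
   it would enlarge [W]. Scalar multiples are therefore obtained as [(c - 1) x + x]. *)
have W0 : W 0.
  apply: contrapT => nW0; apply: (Wmax [set x | W x \/ x = 0]%classic).
    by split=> [x|/(_ 0)] => [|h]; [left | apply: nW0; apply: h; right].
  split=> [c x y [Wx|->] [Wy|->]|x [Wx|//]]; last exact: WI.
  - by left; apply: WP.
  - left; rewrite addr0 -[x]addr0 -[c](subrK 1) scalerDl scale1r.
    by rewrite addr0; apply: WP.
  - by left; rewrite scaler0 add0r.
  - by right; rewrite scaler0 add0r.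
have WZ c x : W x -> W (c *: x) by move=> Wx; rewrite -[_ *: _]addr0; apply: WP.
(* Otherwise [W + k v] is strictly larger and still meets the image only in 0. *)
have dec v : exists i, I i /\ W (v - i).
  apply: contrapT => nv; apply: (Wmax [set x | exists c, W (x - c *: v)]%classic).
    split=> [x Wx|/(_ v) h]; first by exists 0; rewrite scale0r subr0.
    apply: nv; exists 0; split=> //; rewrite subr0; apply: h.
    by exists 1; rewrite scale1r subrr.
  split=> [c x y [a Wa] [b Wb]|x [c Wx] Ix].
    exists (c * a + b); rewrite scalerDl -scalerA opprD addrACA -scalerBr.
    exact: WP.
  have [c0|c0] := eqVneq c 0; first by apply: WI => //; move: Wx; rewrite c0 scale0r subr0.
  case: nv; exists (c^-1 *: x); split; first exact: rpredZ.
  have -> : v - c^-1 *: x = - c^-1 *: (x - c *: v); last exact: WZ.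
  by rewrite scalerBr scaleNr scaleNr scalerA mulVf // scale1r opprK addrC.
have [q qP] := choice dec.
(* Uniqueness of the decomposition makes the chosen component [q] linear. *)
have q_uniq v i : I i -> W (v - i) -> q v = i.
  have [Iq Wq] := qP v => Ii Wi; apply/eqP; rewrite -subr_eq0; apply/eqP.
  apply: WI; last by rewrite addrC -scaleN1r; apply: IP.
  have -> : q v - i = - 1 *: (v - q v) + (v - i); last exact: WP.
  by rewrite scaleN1r opprB addrA subrK.
exists (fun v => LinImage (qP v).1) => [c x y|v]; apply: val_inj => /=.
  apply: q_uniq; first by apply: IP; apply: (qP _).1.
  rewrite opprD addrACA -scalerBr; apply: WP; exact: (qP _).2.
by apply: q_uniq; [exact: (valP v) | rewrite subrr].
Qed.

(** The retraction tensored with the identity is a left inverse. Identities over the image can thus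
    be checked in the ambient space. *)
Lemma tmap_val_inj (k : fieldType) (U V W : lmodType k) (f : {linear U -> V}) :
  injective (tmap (val : lin_image f -> V) (id : W -> W)).
Proof.
have [p lP pK] := lin_image_retraction f.
apply: (can_inj (g := tmap p id)) => t.
by rewrite -[RHS]tlift_id; unfold_tensor; sweedler (rewrite pK).
Qed.

Section StandardSubcalculus.
Variables (k : fieldType) (A : hopfAlgType k).
Variables (L : lmodType k) (r : L -> A -> L) (omega : {linear aug A -> L}).
Hypothesis hd : left_data r omega.
Notation I := (lin_image omega).
Notation im := (to_image omega).

Lemma to_image_surj (v : I) : exists x, im x = v.
Proof. by case: v => v hv; have /asboolP [x e] := hv; exists x; apply: val_inj. Qed.

Fact image_ract_subproof (v : I) (a : A) : r (val v) a \in in_image omega.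
Proof.
have [x <-] := to_image_surj v; have [_ [_ oM]] := hd.
by apply/asboolP; exists (aug_act x a); rewrite oM.
Qed.

Definition image_ract (v : I) (a : A) : I := LinImage (image_ract_subproof v a).

Let lv : lin (val : I -> L) := linear_lin val.
Lemma image_left_data : left_data image_ract im.
Proof.
have [[/bilinI br r1 rM] [_ oM]] := hd.
split; last first.
  by split=> [|x a]; [exact: to_image_linear | apply: val_inj; rewrite /= oM].
split=> [|v|v a b]; last 2 first.
- by apply: val_inj; rewrite /= r1.
- by apply: val_inj; rewrite /= rM.
apply: bilinP; split=> [a|v] c x y; apply: val_inj; rewrite linearP.
  by rewrite -[LHS]/(r (val (c *: x + y)) a) linearP br.1.
exact: br.2.
Qed.

Let X := data_left r omega.
Let X' := data_left image_ract im.
Let incl : forms X' -> forms X := tmap id val.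

Lemma lin_incl : lin incl.
Proof. by rewrite /incl; unfold_tensor; linearity. Qed.

Lemma incl_left_calculus_map : left_calculus_map incl.
Proof.
have [[/bilinI br r1 rM] _] := hd.
have [[/bilinI br' _ _] _] := image_left_data.
have li := lin_incl.
split; first split.
- split; split=> //.
  + by move=> a t; rewrite /incl /=; unfold_tensor; sweedler.
  + by move=> t a; rewrite /incl /=; unfold_tensor; sweedler.
- by move=> a; rewrite /incl /=; unfold_tensor; sweedler.
- by split=> // t; rewrite /incl /=; unfold_tensor; sweedler.
Qed.

Lemma incl_inj : injective incl.
Proof.
have [p lP pK] := lin_image_retraction omega.
apply: (can_inj (g := tmap id p)) => t.
by rewrite -[RHS]tlift_id /incl; unfold_tensor; sweedler (rewrite pK).
Qed.

Lemma bilin_phi : bilin (fun a b : A => lact a (der X b)).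
Proof. by rewrite /=; unfold_tensor; linearity. Qed.

(* Surjectivity of phi onto the image: [a ⊗ omega z = (a S(z_(1))) d z_(2)]. *)
Lemma standard_formE (x : forms X) : standard_form x <-> exists y, incl y = x.
Proof.
have lphi : lin (phi X) by apply: (lin_tlift bilin_phi); exact: lin_id.
split=> [[t ->]|[y <-]].
  by exists (phi X' t); rewrite /phi /incl /=; unfold_tensor; sweedler.
rewrite -[y]tlift_id (lin_pull _ _ lin_incl) /tlift /formal_eval.
elim/big_ind: _ => [|u v [s ->] [t ->]|[a v] _].
- by exists 0; rewrite (lin0 lphi).
- by exists (s + t); have := lphi 1 s t; rewrite !scale1r.
have [z <-] := to_image_surj v.
exists (\tlift_(z1, z2 <- comul (val z)) ((a * antipode z1) ⊗ z2)).
rewrite /incl /phi /=; unfold_tensor; sweedler.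
symmetry; sweedler_lhs (rewrite -mulrA).
(* Writing [z] as its own projection lets a counit be inserted on [z_(1)], which the antipode axiom
   matches with the other side. *)
symmetry; rewrite /= -[in LHS](aug_projK z).
rewrite -[LHS](counitl_lin (f := fun c => a ⊗ omega (aug_proj c))); last by linearity.
etransitivity; last first.
  by eapply (tlift_coassoc (comulA (val z))); [linearity | linearity | split; linearity].
apply: eq_tlift => c1 c2.
rewrite (antipodel_lin (f := fun b => (a * b) ⊗ omega (aug_proj c2))).
  by rewrite mulr1.
by linearity.
Qed.

Lemma incl_standard_subcalculus : standard_subcalculus incl.
Proof.
split; [by case: incl_left_calculus_map | exact: incl_inj | exact: standard_formE].
Qed.
End StandardSubcalculus.

(** * The standard sub-calculus in the bicovariant case *)

Section BiStandardSubcalculus.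
Variables (k : fieldType) (A : hopfAlgType k).
Variables (L : lmodType k) (r : L -> A -> L) (D : L -> (L ⊗ A)%type).
Variable omega : {linear aug A -> L}.
Hypothesis hd : bi_data r D omega.
Notation I := (lin_image omega).
Notation im := (to_image omega).
Let hl := bi_data_left hd.
Let lv : lin (val : I -> L) := linear_lin val.
Let lim := linear_lin im.
Let lD : lin D. Proof. by case: hd => [[_ [] ]]. Qed.

(** By colinearity, [D (omega x)] already comes from [lin_image omega ⊗ A], where the retraction
    undoes the inclusion; by [tmap_val_inj] the result does not depend on the retraction. *)
Lemma image_coact_exists :
  exists2 D' : I -> (I ⊗ A)%type, lin D' & forall v, tmap val id (D' v) = D (val v).
Proof.
have [p lP pK] := lin_image_retraction omega.
exists (fun v => tmap p id (D (val v))); first by unfold_tensor; linearity.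
move=> v; have [x <-] := to_image_surj v.
have [_ [_ [_ oD]]] := hd.
by rewrite /= oD; unfold_tensor; sweedler (rewrite -[omega _]/(val (im _)) pK).
Qed.

Variable D' : I -> (I ⊗ A)%type.
Hypotheses (lD' : lin D') (valD' : forall v, tmap val id (D' v) = D (val v)).

(** Each coaction axiom is checked after the injective inclusion into [L], where [valD'] turns it
    into the axiom for [D]. *)
Lemma image_bi_data : bi_data (image_ract hl) D' im.
Proof.
have [[hr hD cD] [_ [_ oD]]] := hd.
have [/bilinI br _ _] := hr; have [_ DA De] := hD.
have [hr' [_ oM']] := image_left_data hl; have [/bilinI br' _ _] := hr'.
have vD (v : I) : \tlift_(w, b <- D' v) (val w ⊗ b) = D (val v) by exact: valD'.
split; split=> //.
- split=> [|v|v]; first exact: lD'.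
  + apply: tmap_val_inj.
    transitivity (tassoc (tmap D id (D (val v)))).
      by rewrite -vD; unfold_tensor; sweedler; apply: eq_tlift => ? ?; rewrite -vD; sweedler.
    by rewrite DA -vD; unfold_tensor; sweedler.
  + by apply: val_inj; rewrite -[RHS]De -vD; sweedler (rewrite linearZ).
- by move=> v a; apply: tmap_val_inj; rewrite valD' /= cD -vD; unfold_tensor; sweedler.
- split; first exact: to_image_linear.
  by move=> x; apply: tmap_val_inj; rewrite valD' /= oD; unfold_tensor; sweedler.
Qed.

Lemma incl_bi_calculus_map :
  bi_calculus_map (X := data_bi (image_ract hl) D' im) (Y := data_bi r D omega) (tmap id val).
Proof.
have li : lin (tmap id val : (A ⊗ I)%type -> (A ⊗ L)%type) by unfold_tensor; linearity.
have vD (v : I) : \tlift_(w, b <- D' v) (val w ⊗ b) = D (val v) by exact: valD'.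
split; first exact: incl_left_calculus_map.
by split=> [|t]; [exact: li | rewrite /=; unfold_tensor; sweedler (rewrite -vD)].
Qed.

End BiStandardSubcalculus.

Theorem theorem2p5 (k : fieldType) (A : hopfAlgType k)
    (char_k : 2%N \notin [pchar k]) :
  (* (1) *)
  ((forall X : left_precalculus A, left_covariant X ->
      exists (L : lmodType k) (r : L -> A -> L) (omega : {linear aug A -> L}),
        left_data r omega /\ left_calculus_iso X (data_left r omega))
   /\ (forall (L : lmodType k) (r : L -> A -> L) (omega : {linear aug A -> L}),
        left_data r omega -> left_covariant (data_left r omega)))
  (* (2) *)
  /\ ((forall X : bi_precalculus A, bicovariant X ->
      exists (L : lmodType k) (r : L -> A -> L) (D : L -> L ⊗ A)
             (omega : {linear aug A -> L}),
        bi_data r D omega /\ bi_calculus_iso X (data_bi r D omega))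
   /\ (forall (L : lmodType k) (r : L -> A -> L) (D : L -> L ⊗ A)
             (omega : {linear aug A -> L}),
        bi_data r D omega -> bicovariant (data_bi r D omega)))
  (* (3) *)
  /\ ((forall (L : lmodType k) (r : L -> A -> L) (omega : {linear aug A -> L}),
        left_data r omega ->
        exists r' : lin_image omega -> A -> lin_image omega,
          let X := data_left r omega in
          let X' := data_left r' (to_image omega) in
          let incl : forms X' -> forms X := tmap id val in
          [/\ forall v a, val (r' v a) = r (val v) a,
              left_data r' (to_image omega),
              standard_subcalculus incl
            & left_calculus_map incl])
   /\ (forall (L : lmodType k) (r : L -> A -> L) (D : L -> L ⊗ A)
             (omega : {linear aug A -> L}),
        bi_data r D omega ->
        exists (r' : lin_image omega -> A -> lin_image omega)
               (D' : lin_image omega -> lin_image omega ⊗ A),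
          let X := data_bi r D omega in
          let X' := data_bi r' D' (to_image omega) in
          let incl : forms X' -> forms X := tmap id val in
          [/\ forall v a, val (r' v a) = r (val v) a,
              forall v, tmap val id (D' v) = D (val v),
              bi_data r' D' (to_image omega),
              standard_subcalculus incl
            & bi_calculus_map incl])).
Proof.
split; [split|split; [split|split]].
- exact: left_covariant_classification.
- exact: data_left_covariant.
- exact: bicovariant_classification.
- exact: data_bicovariant.
- move=> L r omega hd; exists (image_ract hd); split=> //.
  + exact: image_left_data.
  + exact: incl_standard_subcalculus.
  + exact: incl_left_calculus_map.
- move=> L r D omega hd; have [D' lD' valD'] := image_coact_exists hd.
  exists (image_ract (bi_data_left hd)), D'; split=> //.
  + exact: image_bi_data.
  + exact: incl_standard_subcalculus.
  + exact: incl_bi_calculus_map.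
Qed.
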